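(* Let $Y_1,\dots,Y_n$ be observations from the sparse deconvolution model of the context, with $\theta_i$ having distribution $f(x)=\mu_nf_0(x)+(1-\mu_n)\delta(x)$, and let $\Phi_\mu=\int\varphi(x)f_0(x)\,dx$. If, for some $C_I>0$, there exist two pdfs $f_1(\theta)$ and $f_2(\theta)$ such that $$I_k=\int_{-\infty}^\infty g^{-1}(x)\Big[\int_{-\infty}^\infty g(x-\theta)f_k(\theta)\,d\theta\Big]^2dx\le C_I<\infty,\qquad k=1,2,$$ and $$\Delta_{12}=\int_{-\infty}^\infty\varphi(\theta)[f_1(\theta)-f_2(\theta)]\,d\theta\ne0,$$ then $$\inf_{\widetilde\Phi_\mu}\ \sup_{f_1,f_2}\ \mathbb E(\widetilde\Phi_\mu-\Phi_\mu)^2\ge C\min\big(1,(n\mu_n^2)^{-1}\big),$$ where $\widetilde\Phi_\mu$ is any estimator of $\Phi_\mu$ based on the observations $Y_1,\dots,Y_n$, and the supremum is over the pdfs $f_1,f_2$ (taken in the role of $f_0$).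
   Context: Model: $Y_i=\theta_i+\xi_i$, $i=1,\dots,n$, where $\xi_i$ are i.i.d. with known pdf $g$, independent of the i.i.d. $\theta_i$, whose distribution is $f(x)=\mu_nf_0(x)+(1-\mu_n)\delta(x)$; here $\delta$ is the Dirac delta at $0$, $\mu_n$ is known and $f_0$ is an unknown pdf (the pdf of the nonzero $\theta_i$). $\varphi$ is a known function, not required to be integrable or square integrable. $C$ denotes a positive constant independent of $n$. *)

(* Defs.v *)
From HB Require Import structures.
From mathcomp Require Import all_boot all_order all_algebra.
From mathcomp Require Import all_classical all_reals all_analysis.
From mathcomp Require Import interval_inference measurable_realfun.

Set Implicit Arguments.
Unset Strict Implicit.
Unset Printing Implicit Defensive.
Import Order.TTheory GRing.Theory Num.Theory.
Import numFieldNormedType.Exports.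

Local Open Scope classical_set_scope.
Local Open Scope ring_scope.
Local Open Scope ereal_scope.

Record pdf (R : realType) := Pdf {
  pdf_fun :> R -> R ;
  measurable_pdf : measurable_fun setT pdf_fun ;
  pdf_ge0 : forall x, (0 <= pdf_fun x)%R ;
  integral_pdf : \int[lebesgue_measure]_x (pdf_fun x)%:E = 1 }.

Section pdf_law.
Context (R : realType) (p : pdf R).

Definition pdf_law (A : set (measurableTypeR R)) : \bar R :=
  \int[lebesgue_measure]_(x in A) (p x)%:E.

Let pdf_law0 : pdf_law set0 = 0.
Proof. by rewrite /pdf_law integral_set0. Qed.

Let pdf_law_ge0 A : 0 <= pdf_law A.
Proof. by apply: integral_ge0 => x _; rewrite lee_fin pdf_ge0. Qed.

Let pdf_law_sigma_additive : semi_sigma_additive pdf_law.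
Proof.
move=> /= F mF tF mUF; rewrite /pdf_law; apply: cvg_toP.
  apply: ereal_nondecreasing_is_cvgn => m n mn.
  apply: lee_sum_nneg_natr => // k _ _; apply: integral_ge0 => /= x Fkx.
  by rewrite lee_fin pdf_ge0.
rewrite ge0_integral_bigcup//=.
- by apply: measurable_funTS; apply/measurable_EFinP; exact: measurable_pdf.
- by move=> x _; rewrite lee_fin pdf_ge0.
Qed.

HB.instance Definition _ := isMeasure.Build _ _ _ pdf_law
  pdf_law0 pdf_law_ge0 pdf_law_sigma_additive.

Let pdf_law_setT : pdf_law setT = 1.
Proof. exact: integral_pdf. Qed.

HB.instance Definition _ :=
  @Measure_isProbability.Build _ _ R pdf_law pdf_law_setT.

End pdf_law.

Section theta_law.
Context (R : realType) (m : {i01 R}) (f0 : pdf R).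

(* The mixture m f0(x) dx + (1 - m) delta_0. *)
Definition theta_law (A : set (measurableTypeR R)) : \bar R :=
  (m%:num)%:E * pdf_law f0 A + (1 - m%:num)%:E * \d_(0%R : measurableTypeR R) A.

Let m_ge0 : (0 <= m%:num)%R.
Proof. by []. Qed.

Let onem_ge0 : (0 <= 1 - m%:num)%R.
Proof. by rewrite subr_ge0. Qed.

Let mixture : {measure set (measurableTypeR R) -> \bar R} :=
  measure_add (mscale (NngNum m_ge0) (pdf_law f0))
    (mscale (NngNum onem_ge0) \d_(0%R : measurableTypeR R)).

Let theta_lawE : theta_law = mixture.
Proof. by apply/funext => A; exact/esym/measure_addE. Qed.

Let theta_law0 : theta_law set0 = 0.
Proof. by rewrite theta_lawE; exact: measure0. Qed.

Let theta_law_ge0 A : 0 <= theta_law A.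
Proof. by rewrite theta_lawE; exact: measure_ge0. Qed.

Let theta_law_sigma_additive : semi_sigma_additive theta_law.
Proof. by rewrite theta_lawE; exact: measure_semi_sigma_additive. Qed.

HB.instance Definition _ := isMeasure.Build _ _ _ theta_law
  theta_law0 theta_law_ge0 theta_law_sigma_additive.

Let theta_law_setT : theta_law setT = 1.
Proof.
by rewrite /theta_law probability_setT diracT !mule1 -EFinD addrC subrK.
Qed.

HB.instance Definition _ :=
  @Measure_isProbability.Build _ _ R theta_law theta_law_setT.

End theta_law.

Section iid_law.
Context d (T : measurableType d) (R : realType).

Definition tuple_cons n (x : T * n.-tuple T) : n.+1.-tuple T :=
  [tuple of x.1 :: x.2].

Lemma measurable_tuple_cons n : measurable_fun setT (@tuple_cons n).
Proof. by apply: measurable_cons. Qed.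

HB.instance Definition _ n :=
  isMeasurableFun.Build _ _ _ _ (@tuple_cons n) (@measurable_tuple_cons n).

(* The n-fold product of P, i.e. the joint law of n i.i.d. draws from P. *)
Fixpoint iid_law (P : probability T R) n : probability (n.-tuple T) R :=
  if n is k.+1 then distribution (P \x iid_law P k) (@tuple_cons k)
  else \d_[tuple].

End iid_law.

Section sparse_deconvolution.
Context (R : realType).
Notation leb := (@lebesgue_measure R).
Notation RT := (measurableTypeR R).

Definition signal_plus_noise (z : RT * RT) : RT := (z.1 + z.2)%R.

Lemma measurable_signal_plus_noise : measurable_fun setT signal_plus_noise.
Proof. exact: measurable_funD. Qed.

HB.instance Definition _ := isMeasurableFun.Build _ _ _ _
  signal_plus_noise measurable_signal_plus_noise.

(* The law of Y = theta + xi, with theta and xi independent of respective laws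
   m f0(x) dx + (1 - m) delta_0 and g(x) dx. *)
Definition observation_law (g : pdf R) (m : {i01 R}) (f0 : pdf R)
    : probability RT R :=
  distribution (theta_law m f0 \x pdf_law g) signal_plus_noise.

Definition Phi (phi : R -> R) (f0 : pdf R) : R :=
  (\int[leb]_x (phi x * f0 x))%R.

(* E (T(Y_1, ..., Y_n) - Phi)^2 when f0 is the pdf of the nonzero theta_i. *)
Definition mse (g : pdf R) (phi : R -> R) n (m : {i01 R})
    (T : n.-tuple RT -> R) (f0 : pdf R) : \bar R :=
  \int[iid_law (observation_law g m f0) n]_y ((T y - Phi phi f0) ^+ 2)%:E.

(* The arithmetic is that of \bar R, where 0^-1 = +oo and +oo * 0 = 0: the
   integrand is +oo at the points where g vanishes and the convolution does
   not, and 0 where both vanish. *)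
Definition Ifun (g f : pdf R) : \bar R :=
  \int[leb]_x ((g x)%:E^-1 *
    (\int[leb]_theta (g (x - theta)%R * f theta)%:E) ^+ 2).

(* The integrability conditions say that the functional of interest is
   well defined at both pdfs. *)
Definition admissible (g : pdf R) (phi : R -> R) (CI : R)
    : set (pdf R * pdf R) :=
  [set f | [/\ Ifun g f.1 <= CI%:E, Ifun g f.2 <= CI%:E,
    leb.-integrable setT (fun x => (phi x * f.1 x)%:E),
    leb.-integrable setT (fun x => (phi x * f.2 x)%:E) &
    (\int[leb]_theta (phi theta * (f.1 theta - f.2 theta)))%R != 0%R]].

(* The infimum is over all measurable real functions of the sample.  The
   supremum is over all admissible pairs, either member being taken as f0; for
   one fixed pair the two hypotheses could be told apart exponentially fast
   in n. *)
Definition minimax_risk (g : pdf R) (phi : R -> R) (CI : R) n (m : {i01 R})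
    : \bar R :=
  ereal_inf [set ereal_sup
      [set maxe (mse g phi m T f.1) (mse g phi m T f.2)
         | f in admissible g phi CI]
    | T in [set T : n.-tuple RT -> R | measurable_fun setT T]].

End sparse_deconvolution.

(* Main.v *)
(** Le Cam's two-point method.  For an admissible pair (f1, f2), the convex
combinations h1 = (f1 + f2) / 2 and h2 = (1/2 + s) f1 + (1/2 - s) f2 form an
admissible pair whose functionals differ by s times Delta_12, and the densities
of Y under them differ by s mu (g * f1 - g * f2).  Their chi^2 divergence is
therefore O(s^2 mu^2): the density under h1 dominates both (1 - mu) g, which is
used for mu <= 1/2 through the bound on I_k, and mu (g * f1 + g * f2) / 2,
which is used for mu >= 1/2.  With s^2 of order min(1, 1 / (n mu^2)) the
chi^2 divergence of the n-fold products stays bounded. *)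
Require Import Defs.
From HB Require Import structures.
From mathcomp Require Import all_boot all_order all_algebra.
From mathcomp Require Import all_classical all_reals all_analysis.
From mathcomp Require Import interval_inference measurable_realfun.
From mathcomp Require Import ring lra.

Set Implicit Arguments.
Unset Strict Implicit.
Unset Printing Implicit Defensive.
Import Order.TTheory GRing.Theory Num.Theory.
Import numFieldNormedType.Exports.
Local Open Scope classical_set_scope.
Local Open Scope ring_scope.

(** * Integration against a law given by a density *)

Section pdf_law_integral.
Local Open Scope ereal_scope.
Context (R : realType) (p : pdf R).
Notation leb := (@lebesgue_measure R).
Notation RT := (measurableTypeR R).

Let mp : measurable_fun setT (EFin \o p : RT -> \bar R).
Proof. by apply/measurable_EFinP; exact: measurable_pdf. Qed.

Import HBNNSimple.

Let pdf_law_indic E : measurable E ->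
  \int[pdf_law p]_x (\1_E x)%:E = \int[leb]_x ((\1_E x)%:E * (p x)%:E).
Proof.
move=> mE; rewrite integral_indic// setIT [LHS]/= /pdf_law integral_mkcond.
apply: eq_integral => x _; rewrite patchE indicE.
by case: ifPn; rewrite ?mul1e ?mul0e.
Qed.

Let pdf_law_nnsfun (f : {nnsfun measurableTypeR R >-> R}) :
  \int[pdf_law p]_x (f x)%:E = \int[leb]_x ((f x)%:E * (p x)%:E).
Proof.
under [LHS]eq_integral do rewrite fimfunE -fsumEFin//.
rewrite [LHS]ge0_integral_fsum//; last 2 first.
  - by move=> r; exact/measurable_EFinP/measurableT_comp.
  - by move=> n x _; rewrite EFinM nnfun_muleindic_ge0.
under [RHS]eq_integral.
  move=> x xD; rewrite fimfunE -fsumEFin// ge0_mule_fsuml; last first.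
    by move=> r; rewrite EFinM nnfun_muleindic_ge0.
  over.
rewrite [RHS]ge0_integral_fsum//; last 2 first.
  - move=> r; apply: emeasurable_funM => //.
    by apply/measurable_EFinP; do 2 apply/measurableT_comp => //.
  - move=> n x _; apply: mule_ge0; last by rewrite lee_fin pdf_ge0.
    by rewrite EFinM nnfun_muleindic_ge0.
apply: eq_fsbigr => r _.
under [RHS]eq_integral do rewrite EFinM -muleA.
(* A negative value [r] has an empty fibre, because [f] is nonnegative. Setting it apart leaves a
   nonnegative scalar to pull out of the integral. *)
have [r0|r0] := leP 0%R r; last first.
  have E0 x : (\1_(f @^-1` [set r]) x : R) = 0%R.
    rewrite indicE memNset//= => fxr.
    by have /(_ x) : forall x, (0 <= f x)%R by []; rewrite fxr leNgt r0.
  by rewrite !integral0_eq// => x _; rewrite E0 ?(mulr0, mul0e, mule0).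
under eq_integral do rewrite EFinM.
rewrite !ge0_integralZl//.
- by rewrite pdf_law_indic.
- by apply: emeasurable_funM => //; apply/measurable_EFinP.
- by move=> x _; rewrite mule_ge0// lee_fin pdf_ge0.
- exact/measurable_EFinP.
Qed.

(** The standard extension: indicators, then nonnegative simple functions, then monotone convergence
    on both sides. Multiplication by the finite number [p x] passes to the limit. *)
Lemma ge0_integral_pdf_law (f : RT -> \bar R) :
  measurable_fun setT f -> (forall x, 0 <= f x) ->
  \int[pdf_law p]_x f x = \int[leb]_x (f x * (p x)%:E).
Proof.
move=> mf f0.
pose f_ := nnsfun_approx measurableT mf.
transitivity (lim (\int[pdf_law p]_x (f_ n x)%:E @[n --> \oo])).
  rewrite -monotone_convergence//=.
  - apply: eq_integral => x _; apply/esym/cvg_lim => //=.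
    exact: cvg_nnsfun_approx.
  - by move=> n; exact/measurable_EFinP/measurable_funTS.
  - by move=> n x _; rewrite lee_fin.
  - by move=> x _ a b ab; rewrite lee_fin; exact/lefP/nd_nnsfun_approx.
transitivity (lim (\int[leb]_x ((f_ n x)%:E * (p x)%:E) @[n --> \oo])).
  by apply: congr_lim; apply/funext => n; exact: pdf_law_nnsfun.
rewrite -monotone_convergence//=.
- apply: eq_integral => x _; apply/cvg_lim => //=.
  by apply: cvgeZr => //; exact: cvg_nnsfun_approx.
- move=> n; apply: emeasurable_funM => //.
  exact/measurable_EFinP/measurable_funTS.
- by move=> n x _; rewrite mule_ge0// lee_fin// pdf_ge0.
- move=> x _ a b ab; rewrite lee_wpmul2r// ?lee_fin ?pdf_ge0//.
  exact/lefP/nd_nnsfun_approx.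
Qed.

End pdf_law_integral.

(** * Translation invariance of Lebesgue measure *)

Section lebesgue_translation.
Local Open Scope ereal_scope.
Context (R : realType).
Notation leb := (@lebesgue_measure R).
Notation RT := (measurableTypeR R).

(** Lebesgue measure is determined by its values on the intervals []a, b]], and the preimage of such
    an interval under a translation is an interval of the same length. *)
Lemma lebesgue_measure_translate (c : R) (A : set RT) : measurable A ->
  pushforward leb (fun x : RT => c + x : RT)%R A = leb A.
Proof.
have mc : measurable_fun setT (fun x : RT => c + x : RT)%R.
  exact: measurable_funD.
pose h : {mfun RT >-> RT} :=
  HB.pack (fun x : RT => c + x : RT)%R
    (isMeasurableFun.Build _ _ _ _ _ mc).
move=> mA; apply/esym.
apply: (@lebesgue_measure_unique _ (pushforward leb h)) => //= _ [[a b]] _ <-.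
rewrite /pushforward/=.
have -> : (fun x => c + x)%R @^-1` `]a, b] = `](a - c)%R, (b - c)%R]%classic.
  by apply/seteqP; split => x /=; rewrite !in_itv/= ltrBlDl lerBrDl.
rewrite !lebesgue_measure_itv/= !lte_fin ltrD2r.
by case: ifPn => // _; rewrite -!EFinD; congr EFin; ring.
Qed.

Lemma ge0_integral_translate (c : R) (f : RT -> \bar R) :
  measurable_fun setT f -> (forall x, 0 <= f x) ->
  \int[leb]_x f (c + x)%R = \int[leb]_x f x.
Proof.
move=> mf f0.
have mc : measurable_fun setT (fun x : RT => c + x : RT)%R.
  exact: measurable_funD.
have := @ge0_integral_pushforward _ _ _ _ _ _ mc leb setT f measurableT mf.
rewrite preimage_setT => <-; last by [].
by apply: eq_measure_integral => A mA _; exact: lebesgue_measure_translate.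
Qed.

End lebesgue_translation.

(** * Chi-square domination, its tensorization and the two-point bound *)

Section chi2_domination.
Local Open Scope ereal_scope.

Lemma emeasurable_sqre d (T : measurableType d) (R : realType)
    (f : T -> \bar R) :
  measurable_fun setT f -> measurable_fun setT (fun x => f x ^+ 2).
Proof.
by move=> mf; under eq_fun do rewrite expe2; exact: emeasurable_funM.
Qed.

(* Optimal at s = K / A; this replaces Cauchy-Schwarz and its square roots. *)
Lemma sqre_le_of_AMGM (R : realType) (A B : \bar R) (K : R) :
  (0 < K)%R -> 0 <= A -> 0 <= B ->
  (forall s : R, (0 < s)%R -> A + A <= s%:E * B + (s^-1 * K)%:E) ->
  A ^+ 2 <= K%:E * B.
Proof.
move=> K0 A0; case: B => [b|_ _|//]; last first.
  by rewrite gt0_muley// leey.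
rewrite lee_fin => b0.
case: A A0 => [a|_ /(_ 1%R ltr01)|//]; last first.
  by rewrite addye// mul1e -EFinD leye_eq.
rewrite lee_fin => a0 H.
(* The case [a = 0] is separate, since the choice [s = K / a] needs [a > 0]. *)
move: a0; rewrite le_eqVlt => /predU1P[<-|a0].
  by rewrite expe2 mule0 mule_ge0// lee_fin// ltW.
have := H _ (divr_gt0 K0 a0).
rewrite expe2 -!EFinM -!EFinD !lee_fin invf_div divfK ?gt_eqF//.
by rewrite lerD2r mulrAC ler_pdivlMr.
Qed.

(* The best such K is 1 + chi^2(Q, P); unlike a bound on densities, this form
   passes to product measures by Tonelli alone. *)
Definition chi2_dom d (T : measurableType d) (R : realType) (K : R)
    (P Q : probability T R) :=
  forall f : T -> \bar R, measurable_fun setT f -> (forall x, 0 <= f x) ->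
    (\int[Q]_x f x) ^+ 2 <= K%:E * \int[P]_x (f x) ^+ 2.

Lemma ge0_integral_iid_lawS d (T : measurableType d) (R : realType)
    (P : probability T R) n (f : n.+1.-tuple T -> \bar R) :
  measurable_fun setT f -> (forall x, 0 <= f x) ->
  \int[iid_law P n.+1]_x f x
    = \int[P]_x \int[iid_law P n]_y f (tuple_cons (x, y)).
Proof.
move=> mf f0; rewrite /= ge0_integral_distribution// fubini_tonelli1//=.
exact: measurableT_comp.
Qed.

(** Induction by splitting off the first observation: the one-draw inequality is applied to the
    inner integral [F], and the induction hypothesis bounds [F x ^+ 2] by [K ^+ n * G x] for each
    fixed first coordinate [x]. *)
Lemma chi2_dom_iid d (T : measurableType d) (R : realType) (K : R)
    (P Q : probability T R) n :
  (0 <= K)%R -> chi2_dom K P Q -> chi2_dom (K ^+ n) (iid_law P n) (iid_law Q n).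
Proof.
move=> K0 PQ; elim: n => [|n IH] f mf f0.
  rewrite expr0 mul1e /= !integral_dirac// ?diracT ?mul1e//.
  exact: emeasurable_sqre.
have mfc : measurable_fun setT (f \o @tuple_cons d T n).
  exact: measurableT_comp.
have mfX : measurable_fun setT (fun x => f x ^+ 2) by exact: emeasurable_sqre.
rewrite !ge0_integral_iid_lawS//; last by move=> x; rewrite sqre_ge0.
pose F x := \int[iid_law Q n]_y f (tuple_cons (x, y)).
pose G x := \int[iid_law P n]_y (f (tuple_cons (x, y)) ^+ 2).
have mF : measurable_fun setT F.
  by apply: (measurable_fun_fubini_tonelli_F (m2 := iid_law Q n)
    (f \o @tuple_cons d T n)) => // x; exact: f0.
have mG : measurable_fun setT G.
  apply: (measurable_fun_fubini_tonelli_F (m2 := iid_law P n)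
    ((fun x => f x ^+ 2) \o @tuple_cons d T n)) => //.
    exact: measurableT_comp.
  by move=> x; rewrite /= sqre_ge0.
have F0 x : 0 <= F x by exact: integral_ge0.
have G0 x : 0 <= G x by apply: integral_ge0 => y _; exact: sqre_ge0.
apply: (le_trans (PQ F mF F0)).
rewrite exprS EFinM -muleA lee_wpmul2l ?lee_fin//.
rewrite -ge0_integralZl//; first last.
- by rewrite lee_fin exprn_ge0.
- by move=> x _; exact: G0.
apply: ge0_le_integral => //.
- by move=> x _; rewrite sqre_ge0.
- exact: emeasurable_sqre.
- exact: emeasurable_funM.
- move=> x _; apply: IH => //.
  by apply: (measurableT_comp mfc); exact: pair1_measurable.
Qed.

(** This is Jensen's inequality for the square. It follows by integrating [2 f <= s f^2 + 1/s]
    against a measure of mass 1. *)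
Lemma chi2_dom_refl d (T : measurableType d) (R : realType)
    (P : probability T R) : chi2_dom 1 P P.
Proof.
move=> f mf f0; apply: sqre_le_of_AMGM => //.
- exact: integral_ge0.
- by apply: integral_ge0 => x _; exact: sqre_ge0.
move=> s s0; rewrite mulr1.
have -> : (s^-1)%:E = \int[P]_x (s^-1)%:E.
  by rewrite integral_cst// [X in _ * X]probability_setT mule1.
have mfX : measurable_fun setT (fun x => f x ^+ 2) by exact: emeasurable_sqre.
rewrite -ge0_integralD// -ge0_integralZl//; last 2 first.
- by move=> x _; exact: sqre_ge0.
- by rewrite lee_fin ltW.
rewrite -ge0_integralD//; first last.
- by move=> x _; rewrite lee_fin invr_ge0 ltW.
- exact: emeasurable_funM.
- by move=> x _; rewrite mule_ge0 ?sqre_ge0// lee_fin ltW.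
apply: ge0_le_integral => //.
- by move=> x _; rewrite adde_ge0.
- exact: emeasurable_funD.
- by apply: emeasurable_funD => //; exact: emeasurable_funM.
move=> x _; case: (f x) (f0 x) => [r _|_|//]; last first.
  by rewrite expe2 mulyy gt0_muley// addye// leey.
rewrite expe2 -!EFinM -!EFinD lee_fin.
have -> : (r + r = s * (r * r) + s^-1 - s^-1 * (s * r - 1) ^+ 2)%R.
  by field; rewrite gt_eqF.
by rewrite gerBl mulr_ge0 ?sqr_ge0// invr_ge0 ltW.
Qed.

(* (E_Q |T - a|)^2 <= K E_P (T - a)^2 and (E_Q |T - b|)^2 <= E_Q (T - b)^2,
   while |a - b| <= E_Q |T - a| + E_Q |T - b|. *)
Lemma two_point_lower_bound d (T : measurableType d) (R : realType) (K : R)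
    (P Q : probability T R) (t : T -> R) (a b : R) :
  (0 <= K)%R -> chi2_dom K P Q -> measurable_fun setT t ->
  ((a - b) ^+ 2 / (2 * (K + 1)))%:E <=
    maxe (\int[P]_x ((t x - a) ^+ 2)%:E) (\int[Q]_x ((t x - b) ^+ 2)%:E).
Proof.
move=> K0 PQ mt; set M := maxe _ _.
pose A := \int[Q]_x (`|t x - a|)%:E.
pose B := \int[Q]_x (`|t x - b|)%:E.
have mta c : measurable_fun setT (fun x => (`|t x - c|)%:E).
  apply/measurable_EFinP; apply: measurableT_comp => //.
  exact: measurable_funB.
have sqE c x : ((`|t x - c|)%:E ^+ 2 = ((t x - c) ^+ 2)%:E).
  by rewrite expe2 -EFinM -normrM ger0_norm -?expr2 ?sqr_ge0.
have HA : A ^+ 2 <= K%:E * M.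
  apply: (le_trans (PQ _ (mta a) _)) => [x|]; first by rewrite lee_fin.
  under eq_integral do rewrite sqE.
  by rewrite lee_wpmul2l ?lee_fin// le_max lexx.
have HB : B ^+ 2 <= M.
  apply: (le_trans (@chi2_dom_refl _ _ _ Q _ (mta b) _)) => [x|].
    by rewrite lee_fin.
  under eq_integral do rewrite sqE.
  by rewrite mul1e le_max lexx orbT.
have A0 : 0 <= A by apply: integral_ge0 => x _; rewrite lee_fin.
have B0 : 0 <= B by apply: integral_ge0 => x _; rewrite lee_fin.
(* As [Q] has mass 1, the constant [|a - b|] is its own integral, so the triangle inequality can be
   integrated. *)
have HAB : (`|a - b|)%:E <= A + B.
  rewrite -ge0_integralD//.
  rewrite -[leLHS]mule1 -(probability_setT Q) -integral_cst//.
  apply: ge0_le_integral => //.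
  - by move=> x _; rewrite lee_fin.
  - exact: emeasurable_funD.
  - move=> x _; rewrite -EFinD lee_fin /cst (distrC (t x)).
    by rewrite (le_trans _ (ler_normD _ _))// addrA subrK.
have M0 : 0 <= M by rewrite (le_trans _ HB)// sqre_ge0.
(* An infinite [M] makes the claim trivial. A finite one forces [A] and [B] to be finite, and what
   remains is real arithmetic: [(A + B)^2 <= 2 (A^2 + B^2) <= 2 (K + 1) M]. *)
case: M M0 HA HB => [M|_ _ _|//]; last by rewrite leey.
rewrite lee_fin => M0.
case: A A0 HAB => [A|_ _|//]; last by rewrite expe2 mulyy -EFinM leye_eq.
case: B B0 => [B|_ _ _ _|//]; last by rewrite expe2 mulyy leye_eq.
rewrite !expe2 -!EFinM -!EFinD !lee_fin => B0 A0 HAB HA HB.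
rewrite ler_pdivrMr ?mulr_gt0 ?ltr_wpDl//.
have H : ((a - b) ^+ 2 <= (A + B) ^+ 2)%R.
  by rewrite -[leLHS]real_normK ?num_real// lerXn2r// nnegrE ?addr_ge0.
have := sqr_ge0 (A - B); nra.
Qed.

End chi2_domination.

(** * The density of one observation *)

Section observation_density.
Local Open Scope ereal_scope.
Context (R : realType).
Notation leb := (@lebesgue_measure R).
Notation RT := (measurableTypeR R).
Implicit Types (m : {i01 R}) (g : pdf R).

Lemma ge0_integral_theta_law m (f0 : pdf R) (F : RT -> \bar R) :
  measurable_fun setT F -> (forall x, 0 <= F x) ->
  \int[theta_law m f0]_x F x
    = (m%:num)%:E * (\int[leb]_x (F x * (f0 x)%:E))
      + (1 - m%:num)%:E * F 0%R.
Proof.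
move=> mF F0.
have m_ge0 : (0 <= m%:num)%R by [].
have onem_ge0 : (0 <= 1 - m%:num)%R by rewrite subr_ge0.
(* Presenting the law as a sum of two scaled measures lets the integral split. *)
pose mix : {measure set RT -> \bar R} :=
  measure_add (mscale (NngNum m_ge0) (pdf_law f0))
    (mscale (NngNum onem_ge0) \d_(0%R : RT)).
rewrite (@eq_measure_integral _ _ _ _ mix); last first.
  by move=> A mA _; exact/esym/measure_addE.
rewrite ge0_integral_measure_add// !ge0_integral_mscale//.
by rewrite ge0_integral_pdf_law// integral_dirac// diracT mul1e.
Qed.

(* May be +oo on a null set, hence the use of fine below. *)
Definition convolution g (f0 : pdf R) (x : RT) : \bar R :=
  \int[leb]_theta (g (x - theta)%R * f0 theta)%:E.

Lemma measurable_convolution_integrand g (f0 : pdf R) :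
  measurable_fun setT
    (fun z : RT * RT => (g (z.1 - z.2)%R * f0 z.2)%:E).
Proof.
apply/measurable_EFinP; apply: measurable_funM.
  apply: (measurableT_comp (f := g : RT -> R)) => /=.
    exact: measurable_pdf.
  exact: measurable_funB.
by apply: (measurableT_comp (f := f0 : RT -> R)) => //=; exact: measurable_pdf.
Qed.

Lemma measurable_convolution g (f0 : pdf R) :
  measurable_fun setT (convolution g f0).
Proof.
apply: (measurable_fun_fubini_tonelli_F (m2 := leb)
  (fun z : RT * RT => (g (z.1 - z.2)%R * f0 z.2)%:E)).
  exact: measurable_convolution_integrand.
by move=> z; rewrite lee_fin mulr_ge0 ?pdf_ge0.
Qed.

Lemma convolution_ge0 g (f0 : pdf R) x : 0 <= convolution g f0 x.
Proof. by apply: integral_ge0 => y _; rewrite lee_fin mulr_ge0 ?pdf_ge0. Qed.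

(** Tonelli separates signal and noise. The shift [x = theta + xi] turns the inner integral into
    that of [f x * g (x - theta)], and a second use of Tonelli on the continuous part produces the
    convolution. The atom at 0 contributes [g] itself. *)
Lemma ge0_integral_observation_law g m (f0 : pdf R) (f : RT -> \bar R) :
  measurable_fun setT f -> (forall x, 0 <= f x) ->
  \int[observation_law g m f0]_x f x =
    (m%:num)%:E * (\int[leb]_x (f x * convolution g f0 x))
    + (1 - m%:num)%:E * (\int[leb]_x (f x * (g x)%:E)).
Proof.
move=> mf fge0.
rewrite ge0_integral_distribution//.
have mfs : measurable_fun setT (f \o @signal_plus_noise R).
  exact: measurableT_comp.
have fs0 z : 0 <= (f \o @signal_plus_noise R) z by exact: fge0.
rewrite fubini_tonelli1//.
pose F (t : RT) := \int[leb]_x (f x * (g (x - t)%R)%:E).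
have mg : measurable_fun setT (fun z : RT * RT => f z.1 * (g (z.1 - z.2)%R)%:E).
  apply: emeasurable_funM; first exact: measurableT_comp.
  apply/measurable_EFinP.
  apply: (measurableT_comp (f := g : RT -> R)) => /=.
    exact: measurable_pdf.
  exact: measurable_funB.
have g0 (z : RT * RT) : 0 <= f z.1 * (g (z.1 - z.2)%R)%:E.
  by rewrite mule_ge0// lee_fin pdf_ge0.
have mF : measurable_fun setT F.
  exact: (measurable_fun_fubini_tonelli_G (m1 := leb) _ mg g0).
have F0 t : 0 <= F t by apply: integral_ge0 => x _; exact: (g0 (x, t)).
have -> : \int[theta_law m f0]_t
    fubini_F (pdf_law g) (f \o @signal_plus_noise R) t
    = \int[theta_law m f0]_t F t.
  apply: eq_integral => t _; rewrite /fubini_F.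
  rewrite ge0_integral_pdf_law//; last first.
    exact: (measurableT_comp mfs (pair1_measurable t)).
  pose h (x : RT) := f x * (g (x - t)%R)%:E.
  transitivity (\int[leb]_x h x); last by [].
  rewrite -(@ge0_integral_translate R t h).
  - by apply: eq_integral => x _; rewrite /h addrAC subrr add0r.
  - exact: (measurableT_comp mg (pair2_measurable t)).
  - by move=> x; exact: (g0 (x, t)).
rewrite ge0_integral_theta_law//; congr (_ * _ + _ * _); last first.
  by apply: eq_integral => x _; rewrite subr0.
transitivity (\int[leb]_t \int[leb]_x
    (f x * (g (x - t)%R * f0 t)%:E)).
  apply: eq_integral => t _; rewrite /F -ge0_integralZr//.
  - by apply: eq_integral => x _; rewrite -muleA EFinM.
  - exact: (measurableT_comp mg (pair2_measurable t)).
  - by move=> x _; exact: (g0 (x, t)).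
  - by rewrite lee_fin pdf_ge0.
rewrite -(fubini_tonelli (fun z : RT * RT =>
  f z.1 * (g (z.1 - z.2)%R * f0 z.2)%:E)).
- apply: eq_integral => x _; rewrite /= ge0_integralZl//.
  + exact: (measurableT_comp (@measurable_convolution_integrand g f0)
      (pair1_measurable x)).
  + by move=> t _; rewrite lee_fin mulr_ge0 ?pdf_ge0.
- apply: emeasurable_funM; first exact: measurableT_comp.
  exact: measurable_convolution_integrand.
- by move=> z; rewrite mule_ge0// lee_fin mulr_ge0 ?pdf_ge0.
Qed.

(** With [m = 1] the density of the observation is the convolution, so testing the previous formula
    on the constant 1 gives its total mass. *)
Lemma integral_convolution g (f0 : pdf R) : \int[leb]_x convolution g f0 x = 1.
Proof.
have := @ge0_integral_observation_law g (Itv01 (@ler01 R) (lexx 1%R)) f0 (cst 1)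
  (measurable_cst _) (fun=> lee01).
rewrite integral_cst// mul1e [X in X = _]probability_setT /= subrr mul0e adde0.
by rewrite mul1e => ->; apply: eq_integral => x _; rewrite mul1e.
Qed.

Lemma convolution_fin_num g (f0 : pdf R) :
  {ae leb, forall x, convolution g f0 x \is a fin_num}.
Proof.
have ci : leb.-integrable setT (convolution g f0).
  apply/integrableP; split; first exact: measurable_convolution.
  under eq_integral do rewrite gee0_abs ?convolution_ge0//.
  by rewrite integral_convolution ltry.
by apply: filterS (integrable_ae measurableT ci) => x /(_ I).
Qed.

Definition observation_pdf g m (f0 : pdf R) (x : RT) : R :=
  (m%:num * fine (convolution g f0 x) + (1 - m%:num) * g x)%R.

Lemma observation_pdf_ge0 g m (f0 : pdf R) x :
  (0 <= observation_pdf g m f0 x)%R.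
Proof.
rewrite addr_ge0// mulr_ge0 ?subr_ge0 ?pdf_ge0//.
exact/fine_ge0/convolution_ge0.
Qed.

Lemma measurable_observation_pdf g m (f0 : pdf R) :
  measurable_fun setT (observation_pdf g m f0).
Proof.
apply: measurable_funD; apply: measurable_funM => //.
  apply: measurableT_comp => //; exact: measurable_convolution.
exact: measurable_pdf.
Qed.

(** The convolution has integral 1, hence is finite almost everywhere, and [fine] alters it on a
    null set only. A real-valued density makes quotients such as [(q - p)^2 / p] available. *)
Lemma ge0_integral_observation_pdf g m (f0 : pdf R) (f : RT -> \bar R) :
  measurable_fun setT f -> (forall x, 0 <= f x) ->
  \int[observation_law g m f0]_x f x
    = \int[leb]_x (f x * (observation_pdf g m f0 x)%:E).
Proof.
move=> mf fge0; rewrite ge0_integral_observation_law//.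
have mc := @measurable_convolution g f0.
have c0 := @convolution_ge0 g f0.
have mg : measurable_fun setT (fun x : RT => (g x)%:E).
  by apply/measurable_EFinP; exact: measurable_pdf.
have om0 : (0 <= 1 - m%:num)%R by rewrite subr_ge0.
rewrite -!ge0_integralZl//; first last.
- by move=> x _; rewrite mule_ge0.
- exact: emeasurable_funM.
- by move=> x _; rewrite mule_ge0// lee_fin pdf_ge0.
- exact: emeasurable_funM.
rewrite -ge0_integralD//; first last.
- by apply: emeasurable_funM => //; exact: emeasurable_funM.
- by move=> x _; rewrite !mule_ge0// lee_fin// pdf_ge0.
- by apply: emeasurable_funM => //; exact: emeasurable_funM.
- by move=> x _; rewrite !mule_ge0// lee_fin.
apply: ge0_ae_eq_integral => //.
- apply: emeasurable_funD; apply: emeasurable_funM => //;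
    exact: emeasurable_funM.
- apply: emeasurable_funM => //; apply/measurable_EFinP.
  exact: measurable_observation_pdf.
- by move=> x _; rewrite adde_ge0 ?mule_ge0// lee_fin// pdf_ge0.
- by move=> x _; rewrite mule_ge0// lee_fin observation_pdf_ge0.
apply: filterS (convolution_fin_num g f0) => x fx _.
have -> : (observation_pdf g m f0 x)%:E
    = (m%:num)%:E * convolution g f0 x + (1 - m%:num)%:E * (g x)%:E.
  by rewrite -[in RHS](fineK fx) -!EFinM -EFinD.
rewrite [RHS]ge0_muleDr//.
  by rewrite !(muleCA (f x)).
all: by rewrite mule_ge0// lee_fin// pdf_ge0.
Qed.

End observation_density.

(** * From densities to chi-square domination *)

Section chi2_density.
Local Open Scope ereal_scope.
Context d (T : measurableType d) (R : realType).
Variable mu : {measure set T -> \bar R}.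

Lemma measurable_invr_ge0 (p : T -> R) : measurable_fun setT p ->
  (forall x, 0 <= p x)%R -> measurable_fun setT (fun x => (p x)^-1)%R.
Proof.
move=> mp p0; under eq_fun do rewrite -powR_inv1//.
exact: (measurableT_comp (measurable_powR (-1)) mp).
Qed.

(** Weighted Cauchy-Schwarz: the square of the integral of [f q] is at most the integral of
    [q^2 / p] times that of [f^2 p], and the former is 1 plus the chi-square divergence. Since
    [x / 0 = 0], the quotient would miss the mass of [q] on [p = 0]; the implication from [p x = 0]
    to [q x = 0] excludes such mass. *)
Lemma chi2_dom_density (P Q : probability T R) (p q : T -> R) (c : R) :
  measurable_fun setT p -> (forall x, 0 <= p x)%R ->
  measurable_fun setT q -> (forall x, 0 <= q x)%R ->
  (forall f : T -> \bar R, measurable_fun setT f -> (forall x, 0 <= f x) ->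
    \int[P]_x f x = \int[mu]_x (f x * (p x)%:E)) ->
  (forall f : T -> \bar R, measurable_fun setT f -> (forall x, 0 <= f x) ->
    \int[Q]_x f x = \int[mu]_x (f x * (q x)%:E)) ->
  (forall x, p x = 0 -> q x = 0)%R ->
  (0 <= c)%R -> \int[mu]_x ((q x - p x) ^+ 2 / p x)%:E <= c%:E ->
  chi2_dom (1 + c) P Q.
Proof.
move=> mp p0 mq q0 Pp Qq pq c0 Hc f mf f0.
have int1 (L : probability T R) (l : T -> R) :
    (forall f : T -> \bar R, measurable_fun setT f -> (forall x, 0 <= f x) ->
    \int[L]_x f x = \int[mu]_x (f x * (l x)%:E)) -> \int[mu]_x (l x)%:E = 1.
  move=> /(_ _ (measurable_cst 1) (fun=> lee01)).
  rewrite integral_cst// mul1e [X in X = _]probability_setT => ->.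
  by apply: eq_integral => x _; rewrite mul1e.
have mEp : measurable_fun setT (fun x => (p x)%:E) by exact/measurable_EFinP.
have mEq : measurable_fun setT (fun x => (q x)%:E) by exact/measurable_EFinP.
have mpV := measurable_invr_ge0 mp p0.
have mY : measurable_fun setT (fun x => ((q x - p x) ^+ 2 / p x)%:E).
  apply/measurable_EFinP/measurable_funM => //.
  by apply: measurable_funX; exact: measurable_funB.
have mX : measurable_fun setT (fun x => (q x ^+ 2 / p x)%:E).
  by apply/measurable_EFinP/measurable_funM => //; exact: measurable_funX.
have Y0 x : 0 <= ((q x - p x) ^+ 2 / p x)%:E.
  by rewrite lee_fin divr_ge0 ?sqr_ge0.
have X0 x : 0 <= (q x ^+ 2 / p x)%:E by rewrite lee_fin divr_ge0 ?sqr_ge0.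
(* q^2/p + p = 2q + (q - p)^2/p, with no subtraction of integrals. *)
have HX : \int[mu]_x (q x ^+ 2 / p x)%:E <= (1 + c)%:E.
  have : \int[mu]_x (q x ^+ 2 / p x)%:E + 1 <= 1 + 1 + c%:E.
    rewrite -{1}(int1 P p Pp) -(int1 Q q Qq) -!ge0_integralD//; first last.
    - by move=> x _; rewrite lee_fin.
    - by move=> x _; rewrite lee_fin.
    - by move=> x _; rewrite lee_fin.
    rewrite (le_trans _ (leeD2l _ Hc))// -ge0_integralD//; first last.
    - exact: emeasurable_funD.
    - by move=> x _; rewrite -EFinD lee_fin addr_ge0.
    rewrite le_eqVlt; apply/orP; left; apply/eqP.
    apply: eq_integral => x _; rewrite -!EFinD; congr EFin.
    have [px0|px0] := eqVneq (p x) 0%R; last by field.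
    by rewrite px0 (pq _ px0) invr0; ring.
  case: (\int[mu]_x _) => [r| |]//.
    by rewrite -!EFinD !lee_fin => ?; lra.
  by move=> _; exact: leNye.
rewrite (Qq f mf f0).
have -> : \int[P]_x (f x ^+ 2) = \int[mu]_x (f x ^+ 2 * (p x)%:E).
  by apply: Pp => [|x]; [exact: emeasurable_sqre|exact: sqre_ge0].
have mfp : measurable_fun setT (fun x => f x ^+ 2 * (p x)%:E).
  by apply: emeasurable_funM => //; exact: emeasurable_sqre.
have mfq : measurable_fun setT (fun x => f x * (q x)%:E).
  exact: emeasurable_funM.
have fp0 x : 0 <= f x ^+ 2 * (p x)%:E by rewrite mule_ge0 ?sqre_ge0 ?lee_fin.
have fq0 x : 0 <= f x * (q x)%:E by rewrite mule_ge0 ?lee_fin.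
apply: sqre_le_of_AMGM.
- by rewrite ltr_wpDr.
- exact: integral_ge0.
- exact: integral_ge0.
move=> s s0.
have sV0 : (0 <= s^-1)%R by rewrite invr_ge0 ltW.
(* Going back from [1 + c] to the integral of [q^2 / p] reduces the goal to a pointwise inequality
   between integrands. *)
have sX : s^-1%:E * \int[mu]_x (q x ^+ 2 / p x)%:E <= (s^-1 * (1 + c))%:E.
  by rewrite EFinM lee_wpmul2l.
rewrite (le_trans _ (leeD2l _ sX))//.
rewrite -!ge0_integralZl ?lee_fin ?(ltW s0)//.
rewrite -!ge0_integralD//; first last.
- exact: emeasurable_funM.
- by move=> x _; rewrite mule_ge0.
- exact: emeasurable_funM.
- by move=> x _; rewrite mule_ge0// lee_fin ltW.
apply: ge0_le_integral => //.
- by move=> x _; rewrite adde_ge0.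
- exact: emeasurable_funD.
- by apply: emeasurable_funD; exact: emeasurable_funM.
move=> x _; have [px0|px0] := eqVneq (p x) 0%R.
  by rewrite px0 (pq _ px0) invr0 mulr0 !mule0 !adde0.
have {}px0 : (0 < p x)%R by rewrite lt_neqAle eq_sym px0 p0.
case: (f x) (f0 x) => [r _|_|//]; last first.
  rewrite [leRHS](_ : _ = +oo) ?leey//.
  by rewrite expe2 mulyy gt0_mulye ?lte_fin// gt0_muley ?lte_fin// addye.
rewrite expe2 -!EFinM -!EFinD lee_fin -subr_ge0.
(* Completing the square shows that the difference of the integrands is nonnegative. *)
have -> : (s * (r * r * p x) + s^-1 * (q x ^+ 2 / p x) - (r * q x + r * q x) =
  (s * r * p x - q x) ^+ 2 / (s * p x))%R.
  by field; rewrite !gt_eqF.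
by rewrite divr_ge0 ?sqr_ge0// mulr_ge0// ltW.
Qed.

End chi2_density.

(** * Convex combinations of two pdfs *)

Section pdf_mixture.
Local Open Scope ereal_scope.
Context (R : realType).
Notation leb := (@lebesgue_measure R).
Notation RT := (measurableTypeR R).
Implicit Types (w m : {i01 R}) (g : pdf R).

Definition mix_fun w (f1 f2 : pdf R) (x : R) : R :=
  (w%:num * f1 x + (1 - w%:num) * f2 x)%R.

Lemma measurable_mix_fun w (f1 f2 : pdf R) :
  measurable_fun setT (mix_fun w f1 f2).
Proof.
by apply: measurable_funD; apply: measurable_funM => //; exact: measurable_pdf.
Qed.

Lemma mix_fun_ge0 w (f1 f2 : pdf R) x : (0 <= mix_fun w f1 f2 x)%R.
Proof. by rewrite addr_ge0// mulr_ge0 ?subr_ge0 ?pdf_ge0. Qed.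

Lemma ge0_integral_mix_fun w (f1 f2 : pdf R) (F : RT -> \bar R) :
  measurable_fun setT F -> (forall x, 0 <= F x) ->
  \int[leb]_x (F x * (mix_fun w f1 f2 x)%:E) =
    (w%:num)%:E * \int[leb]_x (F x * (f1 x)%:E)
    + (1 - w%:num)%:E * \int[leb]_x (F x * (f2 x)%:E).
Proof.
move=> mF F0.
have mFf (f : pdf R) : measurable_fun setT (fun x : RT => F x * (f x)%:E).
  apply: emeasurable_funM => //; apply/measurable_EFinP; exact: measurable_pdf.
have Ff0 (f : pdf R) x : 0 <= F x * (f x)%:E.
  by rewrite mule_ge0 ?lee_fin ?pdf_ge0.
have w0 : 0 <= (w%:num)%:E by rewrite lee_fin.
have ow0 : 0 <= (1 - w%:num)%:E by rewrite lee_fin subr_ge0.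
rewrite -!ge0_integralZl// -ge0_integralD//; first last.
- exact: emeasurable_funM.
- by move=> x _; rewrite mule_ge0.
- exact: emeasurable_funM.
- by move=> x _; rewrite mule_ge0.
apply: eq_integral => x _.
rewrite EFinD ge0_muleDr ?lee_fin ?mulr_ge0 ?pdf_ge0//.
by rewrite !EFinM !(muleCA (F x)).
Qed.

Lemma integral_mix_fun w (f1 f2 : pdf R) :
  \int[leb]_x (mix_fun w f1 f2 x)%:E = 1.
Proof.
have := ge0_integral_mix_fun w f1 f2 (measurable_cst (1 : \bar R))
  (fun=> @lee01 _).
have c1 (h : R -> R) : \int[leb]_x (cst 1 x * (h x)%:E) = \int[leb]_x (h x)%:E.
  by apply: eq_integral => x _; rewrite mul1e.
by rewrite !c1 !integral_pdf !mule1 -EFinD addrC subrK.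
Qed.

Definition pdf_mix w (f1 f2 : pdf R) : pdf R :=
  Pdf (measurable_mix_fun w f1 f2) (mix_fun_ge0 w f1 f2)
    (integral_mix_fun w f1 f2).

Lemma convolution_mix g w (f1 f2 : pdf R) x :
  convolution g (pdf_mix w f1 f2) x =
    (w%:num)%:E * convolution g f1 x + (1 - w%:num)%:E * convolution g f2 x.
Proof.
rewrite /convolution.
under eq_integral do rewrite EFinM.
rewrite (ge0_integral_mix_fun w f1 f2 (F := fun t => (g (x - t)%R)%:E)).
- by congr (_ * _ + _ * _); apply: eq_integral => t _; rewrite EFinM.
- apply/measurable_EFinP; apply: (measurableT_comp (f := g : RT -> R)) => /=.
    exact: measurable_pdf.
  exact: measurable_funB.
- by move=> t; rewrite lee_fin pdf_ge0.
Qed.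

(** For finite arguments the gap is [a (1 - a) (x - y)^2]. Weights 0 and 1 are treated first, so
    that afterwards an infinite argument makes the right-hand side infinite. *)
Lemma sqre_convex w (x y : \bar R) : 0 <= x -> 0 <= y ->
  ((w%:num)%:E * x + (1 - w%:num)%:E * y) ^+ 2
    <= (w%:num)%:E * x ^+ 2 + (1 - w%:num)%:E * y ^+ 2.
Proof.
have : (0 <= w%:num)%R by [].
have : (w%:num <= 1)%R by [].
move: (w%:num) => {w} a a1 a0 x0 y0.
have b0 : (0 <= 1 - a)%R by rewrite subr_ge0.
have [->|an0] := eqVneq a 0%R; first by rewrite subr0 !mul0e !add0e !mul1e.
have [->|an1] := eqVneq a 1%R; first by rewrite subrr !mul0e !adde0 !mul1e.
have {}an0 : 0 < a%:E by rewrite lte_fin lt_neqAle eq_sym an0.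
have {}an1 : 0 < (1 - a)%:E by rewrite lte_fin subr_gt0 lt_neqAle an1.
case: x x0 => [x x0|_|//]; last first.
  rewrite [leRHS](_ : _ = +oo) ?leey// (expe2 +oo) mulyy gt0_muley// addye//.
  by rewrite gt_eqF// (lt_le_trans (ltNyr 0)) ?mule_ge0 ?sqre_ge0// ltW.
case: y y0 => [y y0|_|//]; last first.
  rewrite [leRHS](_ : _ = +oo) ?leey// (expe2 +oo) mulyy gt0_muley// addey//.
rewrite !expe2 -!EFinM -!EFinD lee_fin -subr_ge0.
rewrite [leRHS](_ : _ = a * (1 - a) * (x - y) ^+ 2)%R; last by ring.
by rewrite mulr_ge0 ?sqr_ge0// mulr_ge0.
Qed.

Lemma measurable_Ifun_integrand g (f : pdf R) :
  measurable_fun setT (fun x : RT => (g x)%:E^-1 * convolution g f x ^+ 2).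
Proof.
apply: emeasurable_funM; last first.
  by apply: emeasurable_sqre; exact: measurable_convolution.
under eq_fun do rewrite inver.
apply: measurable_fun_ifT => //.
  apply: measurable_fun_eqr => //; exact: measurable_pdf.
apply/measurable_EFinP; apply: (measurable_invr_ge0 (T := RT)).
  exact: measurable_pdf.
exact: pdf_ge0.
Qed.

(** The convolution is affine in the weight and the square is convex, so [Ifun] is convex along the
    segment and any common bound survives. *)
Lemma Ifun_mix g w (f1 f2 : pdf R) (c : R) :
  Ifun g f1 <= c%:E -> Ifun g f2 <= c%:E -> Ifun g (pdf_mix w f1 f2) <= c%:E.
Proof.
move=> I1 I2.
have gV0 x : 0 <= (g x)%:E^-1 by rewrite inve_ge0 lee_fin pdf_ge0.
have w0 : 0 <= (w%:num)%:E by rewrite lee_fin.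
have ow0 : 0 <= (1 - w%:num)%:E by rewrite lee_fin subr_ge0.
have mI := @measurable_Ifun_integrand g.
have I0 (f : pdf R) x : 0 <= (g x)%:E^-1 * convolution g f x ^+ 2.
  by rewrite mule_ge0 ?sqre_ge0.
have -> : c%:E = (w%:num)%:E * c%:E + (1 - w%:num)%:E * c%:E.
  by rewrite -!EFinM -EFinD; congr EFin; ring.
apply: (le_trans _ (leeD (lee_wpmul2l w0 I1) (lee_wpmul2l ow0 I2))).
have IE (f : pdf R) :
    Ifun g f = \int[leb]_x ((g x)%:E^-1 * convolution g f x ^+ 2) by [].
rewrite !IE -(ge0_integralZl _ measurableT (mI f1) _ w0); last first.
  by move=> x _; exact: I0.
rewrite -(ge0_integralZl _ measurableT (mI f2) _ ow0); last first.
  by move=> x _; exact: I0.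
rewrite -ge0_integralD//; first last.
- exact: emeasurable_funM.
- by move=> x _; rewrite mule_ge0.
- exact: emeasurable_funM.
- by move=> x _; rewrite mule_ge0.
apply: ge0_le_integral => //.
- by apply: emeasurable_funD; exact: emeasurable_funM.
move=> x _; rewrite convolution_mix.
rewrite (muleCA (w%:num)%:E) (muleCA (1 - w%:num)%:E) -ge0_muleDr.
- by rewrite lee_wpmul2l// sqre_convex ?convolution_ge0.
- by rewrite mule_ge0 ?sqre_ge0.
- by rewrite mule_ge0 ?sqre_ge0.
Qed.

End pdf_mixture.

(** * The two hypotheses on a segment and their divergence *)

Section two_hypotheses.
Local Open Scope ereal_scope.
Context (R : realType).
Notation leb := (@lebesgue_measure R).
Notation RT := (measurableTypeR R).
Implicit Types (w m : {i01 R}) (g : pdf R).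

(** [observation_pdf] of the mixture agrees with this only where both convolutions are finite.
    Mixing after [fine] makes the density affine in [w] at every point, so differences can be
    computed without exceptional sets. *)
Definition mix_observation_pdf g m w (f1 f2 : pdf R) (x : RT) : R :=
  (w%:num * observation_pdf g m f1 x
   + (1 - w%:num) * observation_pdf g m f2 x)%R.

Lemma measurable_mix_observation_pdf g m w (f1 f2 : pdf R) :
  measurable_fun setT (mix_observation_pdf g m w f1 f2).
Proof.
apply: measurable_funD; apply: measurable_funM => //;
  exact: measurable_observation_pdf.
Qed.

Lemma mix_observation_pdf_ge0 g m w (f1 f2 : pdf R) x :
  (0 <= mix_observation_pdf g m w f1 f2 x)%R.
Proof.
by rewrite addr_ge0// mulr_ge0 ?subr_ge0 ?observation_pdf_ge0.
Qed.

Lemma ge0_integral_observation_law_mix g m w (f1 f2 : pdf R)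
    (f : RT -> \bar R) :
  measurable_fun setT f -> (forall x, 0 <= f x) ->
  \int[observation_law g m (pdf_mix w f1 f2)]_x f x
    = \int[leb]_x (f x * (mix_observation_pdf g m w f1 f2 x)%:E).
Proof.
move=> mf fge0; rewrite ge0_integral_observation_pdf//.
apply: ge0_ae_eq_integral => //.
- apply: emeasurable_funM => //; apply/measurable_EFinP.
  exact: measurable_observation_pdf.
- apply: emeasurable_funM => //; apply/measurable_EFinP.
  exact: measurable_mix_observation_pdf.
- by move=> x _; rewrite mule_ge0// lee_fin observation_pdf_ge0.
- by move=> x _; rewrite mule_ge0// lee_fin mix_observation_pdf_ge0.
apply: filterS2 (convolution_fin_num g f1) (convolution_fin_num g f2)
  => x c1 c2 _.
congr (_ * _%:E); rewrite /observation_pdf /mix_observation_pdf.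
rewrite convolution_mix fineD ?fin_numM// !fineM//= /observation_pdf.
by ring.
Qed.

(* At g = 0 the right-hand side is +oo unless c1 = c2 = 0; the left-hand side
   is 0 when p = 0, real division by 0 giving 0. *)
Lemma chi2_integrand_le (m g p r1 r2 : R) (c1 c2 : \bar R) :
  (0 <= m <= 1)%R -> (0 <= g)%R -> 0 <= c1 -> 0 <= c2 ->
  r1 = fine c1 -> r2 = fine c2 ->
  p = (m * (r1 + r2) / 2 + (1 - m) * g)%R ->
  ((r1 - r2) ^+ 2 / p)%:E <=
    4%:E * (c1 + c2) + 2%:E * (g%:E^-1 * c1 ^+ 2 + g%:E^-1 * c2 ^+ 2).
Proof.
move=> /andP[m0 m1] g0; set B := _ + g%:E^-1 * _.
move=> c10 c20.
have gV0 : 0 <= g%:E^-1 by rewrite inve_ge0 lee_fin.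
have BE : 0 <= 2%:E * B.
  by rewrite mule_ge0 ?lee_fin// adde_ge0// mule_ge0 ?sqre_ge0.
case: c1 c10 @B BE => [x1 x10|_|//] B BE; last first.
  move=> _ _ _; rewrite [leRHS](_ : _ = +oo) ?leey//.
  rewrite addye ?gt0_muley ?lte_fin// ?addye//.
    by rewrite gt_eqF// (lt_le_trans (ltNyr 0)).
  by rewrite gt_eqF// (lt_le_trans (ltNyr 0)).
case: c2 c20 @B BE => [x2 x20|_|//] B BE; last first.
  move=> _ _ _; rewrite [leRHS](_ : _ = +oo) ?leey//.
  rewrite addey ?gt0_muley ?lte_fin// addye//.
  by rewrite gt_eqF// (lt_le_trans (ltNyr 0)).
move=> /= -> -> pE; rewrite lee_fin in x10; rewrite lee_fin in x20.
have p0 : (0 <= p)%R.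
  by rewrite pE addr_ge0 ?mulr_ge0 ?subr_ge0 ?addr_ge0 ?invr_ge0.
have [p_eq0|pn0] := eqVneq p 0%R.
  by rewrite p_eq0 invr0 mulr0 adde_ge0// mule_ge0 ?lee_fin ?addr_ge0.
have {pn0}p0 : (0 < p)%R by rewrite lt_neqAle eq_sym pn0.
(* For [m >= 1/2], [p >= (x1 + x2) / 4] and [(x1 - x2)^2 <= (x1 + x2)^2], whence the factor 4. *)
have [mh|mh] := leP (1 / 2)%R m.
  apply: (@le_trans _ _ (4%:E * (x1%:E + x2%:E))); last by rewrite leeDl.
  rewrite -EFinD -EFinM lee_fin ler_pdivrMr//.
  have : ((x1 + x2) / 4 <= p)%R.
    have : (0 <= (1 - m) * g)%R by rewrite mulr_ge0 ?subr_ge0.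
    by rewrite pE; nra.
  by move=> H; have := mulr_ge0 x10 x20; nra.
(* For [m < 1/2], [p >= g / 2] and [(x1 - x2)^2 <= x1^2 + x2^2], whence the factor 2. *)
apply: (@le_trans _ _ (2%:E * B)); last first.
  by rewrite leeDr// mule_ge0 ?lee_fin ?addr_ge0.
have [g_eq0|gn0] := eqVneq g 0%R.
  rewrite /B g_eq0 inve0.
  have [->|x1n] := eqVneq x1 0%R.
    have [->|x2n] := eqVneq x2 0%R.
      by rewrite subrr expr0n mul0r !expe2 !mule0 adde0 mule0.
    rewrite [leRHS](_ : _ = +oo) ?leey// expe2 !mule0 add0e.
    rewrite expe2 gt0_mulye ?gt0_muley ?lte_fin//.
    by rewrite mulr_gt0// lt_neqAle eq_sym x2n.
  rewrite [leRHS](_ : _ = +oo) ?leey//.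
  rewrite (gt0_mulye (x := x1%:E ^+ 2)); last first.
    by rewrite expe2 lte_fin mulr_gt0// lt_neqAle eq_sym x1n.
  rewrite addye ?gt0_muley ?lte_fin//.
  by rewrite gt_eqF// (lt_le_trans (ltNyr 0))// mule_ge0 ?sqre_ge0// leey.
have {}g0 : (0 < g)%R by rewrite lt_neqAle eq_sym gn0.
rewrite /B inver (negbTE gn0) !expe2 -!EFinM lee_fin ler_pdivrMr//.
have gp : (g / 2 <= p)%R.
  have : (0 <= m * (x1 + x2) / 2)%R by rewrite !mulr_ge0 ?addr_ge0.
  by rewrite pE; nra.
rewrite -mulrDr mulrA -mulrA.
have : (2 / g * p >= 1)%R by rewrite mulrAC ler_pdivlMr//; lra.
move=> H.
have : ((x1 - x2) ^+ 2 <= x1 * x1 + x2 * x2)%R.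
  by have := mulr_ge0 x10 x20; nra.
by have := mulr_ge0 x10 x10; have := mulr_ge0 x20 x20; nra.
Qed.

(** The densities differ by [m s (r1 - r2)], which gives the factor [m^2 s^2]. The pointwise bound
    of [chi2_integrand_le] then integrates to at most [4 (1 + 1) + 2 (CI + CI) = 8 + 4 CI]: two
    convolutions of mass 1 and two values of [Ifun]. *)
Lemma chi2_dom_observation_law_mix g m (h w : {i01 R}) (f1 f2 : pdf R)
    (CI s : R) :
  Ifun g f1 <= CI%:E -> Ifun g f2 <= CI%:E -> (0 < CI)%R ->
  h%:num = (1 / 2)%R -> w%:num = (1 / 2 + s)%R ->
  chi2_dom (1 + (8 + 4 * CI) * (m%:num ^+ 2 * s ^+ 2))
    (observation_law g m (pdf_mix h f1 f2))
    (observation_law g m (pdf_mix w f1 f2)).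
Proof.
move=> I1 I2 CI0 hE wE.
set p := mix_observation_pdf g m h f1 f2.
set q := mix_observation_pdf g m w f1 f2.
pose r1 x := fine (convolution g f1 x).
pose r2 x := fine (convolution g f2 x).
have c1_ge0 := @convolution_ge0 R g f1.
have c2_ge0 := @convolution_ge0 R g f2.
have pE x : (p x = m%:num * (r1 x + r2 x) / 2 + (1 - m%:num) * g x)%R.
  rewrite /p /mix_observation_pdf /observation_pdf hE.
  by rewrite -/(r1 x) -/(r2 x); field.
have qpE x : (q x - p x = (m%:num * s) * (r1 x - r2 x))%R.
  rewrite /p /q /mix_observation_pdf /observation_pdf hE wE.
  by rewrite -/(r1 x) -/(r2 x); field.
have c0 : (0 <= (8 + 4 * CI) * (m%:num ^+ 2 * s ^+ 2))%R.
  by apply: mulr_ge0; [lra|rewrite mulr_ge0 ?sqr_ge0].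
have mp : measurable_fun setT p by exact: measurable_mix_observation_pdf.
have mq : measurable_fun setT q by exact: measurable_mix_observation_pdf.
have p0 : forall x, (0 <= p x)%R by exact: mix_observation_pdf_ge0.
apply: (@chi2_dom_density _ _ _ leb _ _ p q) => //.
- exact: mix_observation_pdf_ge0.
- exact: ge0_integral_observation_law_mix.
- exact: ge0_integral_observation_law_mix.
(* At the midpoint weight, [p x = 0] forces both nonnegative densities to vanish at [x], and with
   them [q x]. *)
- move=> x px0.
  have := observation_pdf_ge0 g m f1 x; have := observation_pdf_ge0 g m f2 x.
  move: px0; rewrite /p /q /mix_observation_pdf hE => px0 a0 b0.
  have -> : observation_pdf g m f1 x = 0%R by lra.
  have -> : observation_pdf g m f2 x = 0%R by lra.
  by rewrite !mulr0 addr0.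
pose U (x : RT) := 4%:E * (convolution g f1 x + convolution g f2 x)
  + 2%:E * ((g x)%:E^-1 * convolution g f1 x ^+ 2
            + (g x)%:E^-1 * convolution g f2 x ^+ 2).
have mc := @measurable_convolution R g.
have mI := @measurable_Ifun_integrand R g.
have gV0 x : 0 <= (g x)%:E^-1 by rewrite inve_ge0 lee_fin pdf_ge0.
have J0 (f : pdf R) x : 0 <= (g x)%:E^-1 * convolution g f x ^+ 2.
  by rewrite mule_ge0 ?sqre_ge0.
have U1_ge0 x : 0 <= 4%:E * (convolution g f1 x + convolution g f2 x).
  by apply: mule_ge0; rewrite ?lee_fin// adde_ge0.
have U2_ge0 x : 0 <= 2%:E * ((g x)%:E^-1 * convolution g f1 x ^+ 2
    + (g x)%:E^-1 * convolution g f2 x ^+ 2).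
  by apply: mule_ge0; rewrite ?lee_fin// adde_ge0.
have U0 x : 0 <= U x by exact: adde_ge0.
have mU1 : measurable_fun setT
    (fun x => convolution g f1 x + convolution g f2 x).
  exact: emeasurable_funD.
have mU2 : measurable_fun setT (fun x : RT =>
    (g x)%:E^-1 * convolution g f1 x ^+ 2
    + (g x)%:E^-1 * convolution g f2 x ^+ 2).
  exact: emeasurable_funD.
have mU : measurable_fun setT U.
  by apply: emeasurable_funD; exact: emeasurable_funM.
have intU1 : \int[leb]_x (convolution g f1 x + convolution g f2 x) = 1 + 1.
  by rewrite (ge0_integralD leb measurableT (fun x _ => c1_ge0 x) (mc f1)
    (fun x _ => c2_ge0 x) (mc f2)) !integral_convolution.
have intU2 : \int[leb]_x ((g x)%:E^-1 * convolution g f1 x ^+ 2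
    + (g x)%:E^-1 * convolution g f2 x ^+ 2) <= CI%:E + CI%:E.
  rewrite (ge0_integralD leb measurableT (fun x _ => J0 f1 x) (mI f1)
    (fun x _ => J0 f2 x) (mI f2)).
  by apply: leeD; [exact: I1|exact: I2].
have intU : \int[leb]_x U x <= (8 + 4 * CI)%:E.
  rewrite ge0_integralD//; first last.
  - exact: emeasurable_funM.
  - exact: emeasurable_funM.
  rewrite (ge0_integralZl _ measurableT mU1) ?lee_fin//; last first.
    by move=> x _; rewrite adde_ge0.
  rewrite (ge0_integralZl _ measurableT mU2) ?lee_fin//; last first.
    by move=> x _; rewrite adde_ge0.
  rewrite [leRHS](_ : _ = 4%:E * (1 + 1) + 2%:E * (CI%:E + CI%:E)); last first.
    rewrite -[1 + 1]EFinD -[CI%:E + _]EFinD -!EFinM -EFinD.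
    by congr EFin; ring.
  by rewrite [X in 4%:E * X]intU1 leeD2l// lee_wpmul2l ?lee_fin.
have ms0 : (0 <= m%:num ^+ 2 * s ^+ 2)%R by rewrite mulr_ge0 ?sqr_ge0.
rewrite EFinM muleC.
apply: le_trans (lee_wpmul2l _ intU); last by rewrite lee_fin.
rewrite -(ge0_integralZl _ measurableT mU) ?lee_fin//.
apply: ge0_le_integral => //.
- by move=> x _; rewrite lee_fin divr_ge0 ?sqr_ge0.
- apply/measurable_EFinP/measurable_funM; last exact: measurable_invr_ge0.
  by apply: measurable_funX; exact: measurable_funB.
- exact: emeasurable_funM.
move=> x _; rewrite qpE exprMn [((_ * s) ^+ 2)%R]exprMn -[X in X%:E]mulrA EFinM.
rewrite lee_wpmul2l ?lee_fin//.
have m01 : (0 <= m%:num <= 1)%R by apply/andP.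
apply: (chi2_integrand_le m01 (pdf_ge0 g x) (c1_ge0 x) (c2_ge0 x)
  erefl erefl (pE x)).
Qed.

Lemma integrable_mix (phi : R -> R) w (f1 f2 : pdf R) :
  leb.-integrable setT (fun x => (phi x * f1 x)%:E) ->
  leb.-integrable setT (fun x => (phi x * f2 x)%:E) ->
  leb.-integrable setT (fun x => (phi x * pdf_mix w f1 f2 x)%:E).
Proof.
move=> i1 i2.
have := integrableD measurableT (integrableZl measurableT w%:num i1)
  (integrableZl measurableT (1 - w%:num)%R i2).
apply: eq_integrable => // x _.
by rewrite /= -!EFinM -EFinD /mix_fun; congr EFin; ring.
Qed.

Lemma Phi_mix (phi : R -> R) w (f1 f2 : pdf R) :
  leb.-integrable setT (fun x => (phi x * f1 x)%:E) ->
  leb.-integrable setT (fun x => (phi x * f2 x)%:E) ->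
  Phi phi (pdf_mix w f1 f2)
    = (w%:num * Phi phi f1 + (1 - w%:num) * Phi phi f2)%R.
Proof.
move=> i1 i2; rewrite /Phi -!RintegralZl// -RintegralD//.
- by apply: eq_Rintegral => x _; rewrite /= /mix_fun; ring.
- exact: (integrableZl measurableT w%:num i1).
- exact: (integrableZl measurableT (1 - w%:num)%R i2).
Qed.

Lemma Rintegral_diff_Phi (phi : R -> R) (f1 f2 : pdf R) :
  leb.-integrable setT (fun x => (phi x * f1 x)%:E) ->
  leb.-integrable setT (fun x => (phi x * f2 x)%:E) ->
  (\int[leb]_t (phi t * (f1 t - f2 t)) = Phi phi f1 - Phi phi f2)%R.
Proof.
move=> i1 i2; rewrite /Phi -RintegralB//.
by apply: eq_Rintegral => x _; rewrite mulrBr.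
Qed.

Lemma admissibleP g (phi : R -> R) (CI : R) (f1 f2 : pdf R) :
  admissible g phi CI (f1, f2) <->
  [/\ Ifun g f1 <= CI%:E, Ifun g f2 <= CI%:E,
    leb.-integrable setT (fun x => (phi x * f1 x)%:E),
    leb.-integrable setT (fun x => (phi x * f2 x)%:E) &
    (Phi phi f1 - Phi phi f2 != 0)%R].
Proof.
split => [[I1 I2 i1 i2 D0]|[I1 I2 i1 i2 D0]].
  split; [exact: I1|exact: I2|exact: i1|exact: i2|].
  by rewrite -(Rintegral_diff_Phi i1 i2); exact: D0.
split; [exact: I1|exact: I2|exact: i1|exact: i2|].
by rewrite (Rintegral_diff_Phi i1 i2); exact: D0.
Qed.

(** [Phi] is affine along the segment, so the gap between the functionals is multiplied by the
    difference of the weights, which is nonzero. *)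
Lemma admissible_mix g (phi : R -> R) (CI : R) (h w : {i01 R})
    (f1 f2 : pdf R) :
  admissible g phi CI (f1, f2) -> h%:num != w%:num ->
  admissible g phi CI (pdf_mix h f1 f2, pdf_mix w f1 f2).
Proof.
move=> /admissibleP[I1 I2 i1 i2 D0] hw; apply/admissibleP.
split; [exact: (Ifun_mix h I1 I2)|exact: (Ifun_mix w I1 I2)|
  exact: (integrable_mix h i1 i2)|exact: (integrable_mix w i1 i2)|].
rewrite (Phi_mix h i1 i2) (Phi_mix w i1 i2).
rewrite [eqbLHS](_ : _ =
  (h%:num - w%:num) * (Phi phi f1 - Phi phi f2))%R; last by ring.
by rewrite mulf_neq0// subr_eq0.
Qed.

End two_hypotheses.

(** * Elementary inequalities and the minimax bound *)

Lemma expr1Dx_le_expR (R : realType) (x : R) n :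
  0 <= x -> (1 + x) ^+ n <= expR (x *+ n).
Proof.
move=> x0; rewrite -mulr_natr expRM_natr.
rewrite lerXn2r// ?nnegrE ?expR_ge0 ?addr_ge0//.
exact: expR_ge1Dx.
Qed.

(** Supplies the rate as a real number [v]. The case [u = 0] is that of a vanishing [mu n], where
    the inverse is [+oo] and the rate is 1. The bound [u * v <= 1] will keep the divergence of the
    samples bounded. *)
Lemma mine1_inv (R : realType) (u : R) : 0 <= u ->
  exists v : R, [/\ 0 < v, v <= 1, u * v <= 1 & (mine 1 (u%:E^-1) = v%:E)%E].
Proof.
rewrite le_eqVlt => /predU1P[<-|u0].
  exists 1; split; rewrite ?ltr01 ?mul0r ?ler01// inve0.
  by rewrite min_l// leey.
exists (Num.min 1 u^-1); split.
- by rewrite lt_min ltr01 invr_gt0.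
- by rewrite ge_min lexx.
- by rewrite -ler_pdivlMl// mulr1 ge_min lexx orbT.
- by rewrite inver gt_eqF// EFin_min.
Qed.

Theorem theorem7 (R : realType) (g : pdf R) (phi : R -> R)
    (mu : nat -> {i01 R}) (CI : R) (CI_gt0 : 0 < CI)
    (exists_pair : exists f1 f2 : pdf R, admissible g phi CI (f1, f2)) :
  exists C : R, 0 < C /\
    forall n : nat, (0 < n)%N ->
      (C%:E * mine 1 ((n%:R * (mu n)%:num ^+ 2)%:E^-1)
        <= minimax_risk g phi CI n (mu n))%E.
Proof.
have [f1 [f2 adm]] := exists_pair.
have [I1 I2 i1 i2 D0] := (admissibleP _ _ _ _ _).1 adm.
set D := Phi phi f1 - Phi phi f2 in D0.
(* [K] will bound [(1 + c) ^+ n] uniformly in [n]. In the constant below, 32 is the 2 of the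
   two-point bound times the 16 of [s^2 = v / 16]. *)
pose K := expR (8 + 4 * CI).
exists (D ^+ 2 / (32 * (K + 1))); split.
  by rewrite divr_gt0 ?exprn_even_gt0// mulr_gt0// addr_gt0 ?expR_gt0.
move=> n n0; set m := mu n.
have [v [v0 v1 uv ->]] :=
  @mine1_inv R (n%:R * m%:num ^+ 2) (mulr_ge0 (ler0n _ _) (sqr_ge0 _)).
(* Division by 4 gives [s <= 1/4], so that [1/2 + s] is a legitimate weight. *)
pose s := Num.sqrt v / 4.
have s0 : 0 < s by rewrite divr_gt0 ?sqrtr_gt0.
have s2 : s ^+ 2 = v / 16.
  by rewrite expr_div_n sqr_sqrtr ?(ltW v0)//; congr (_ / _); ring.
have s1 : s <= 1 / 4.
  by rewrite ler_pM2r ?invr_gt0// -sqrtr1 ler_wsqrtr.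
have h0 : 0 <= (1 / 2 : R) by lra.
have h1 : (1 / 2 : R) <= 1 by lra.
have w0 : 0 <= 1 / 2 + s by lra.
have w1 : 1 / 2 + s <= 1 by lra.
pose h := Itv01 h0 h1; pose w := Itv01 w0 w1.
pose F1 := pdf_mix h f1 f2; pose F2 := pdf_mix w f1 f2.
have adm' : admissible g phi CI (F1, F2).
  by apply: admissible_mix => //=; rewrite lt_eqF//; lra.
pose c := (8 + 4 * CI) * (m%:num ^+ 2 * s ^+ 2).
have c0 : 0 <= c.
  by apply: mulr_ge0; [lra|rewrite mulr_ge0 ?sqr_ge0].
have dom : chi2_dom (1 + c) (observation_law g m F1) (observation_law g m F2).
  have hE : h%:num = 1 / 2 by [].
  have wE : w%:num = 1 / 2 + s by [].
  exact: (chi2_dom_observation_law_mix m I1 I2 CI_gt0 hE wE).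
(* The estimator is arbitrary but fixed from here on, and the supremum is bounded below by its value
   at the single pair [(F1, F2)]. *)
apply: le_ereal_inf_tmp => _ [T mT <-].
apply: le_ereal_sup_tmp.
exists (maxe (mse g phi m T F1) (mse g phi m T F2)).
  by exists (F1, F2); [exact: adm'|].
have Kn0 : 0 <= (1 + c) ^+ n by rewrite exprn_ge0// addr_ge0.
have dom_n := chi2_dom_iid (n := n) (addr_ge0 ler01 c0) dom.
have LB := two_point_lower_bound (Phi phi F1) (Phi phi F2) Kn0 dom_n mT.
apply: le_trans LB.
have -> : Phi phi F1 - Phi phi F2 = - s * D.
  by rewrite /D (Phi_mix h i1 i2) (Phi_mix w i1 i2) /=; ring.
(* The power is at most [exp (n c)], and [n c] is [(8 + 4 CI) / 16] times [n m^2 v <= 1]. *)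
have KnK : (1 + c) ^+ n <= K.
  apply: (le_trans (expr1Dx_le_expR n c0)); rewrite ler_expR.
  have -> : c *+ n = (8 + 4 * CI) / 16 * (n%:R * m%:num ^+ 2 * v).
    by rewrite -(mulr_natr c) /c s2; field.
  nra.
rewrite -EFinM lee_fin exprMn sqrrN s2.
rewrite [leLHS](_ : _ = v / 16 * D ^+ 2 / (2 * (K + 1))); last first.
  by field; rewrite gt_eqF// addr_gt0 ?expR_gt0.
(* Both sides share the numerator [s^2 D^2], so only the denominators, with [K] and with
   [(1 + c) ^+ n], remain to be compared. *)
apply: ler_wpM2l.
  by apply: mulr_ge0; [rewrite divr_ge0 ?(ltW v0)|exact: sqr_ge0].
rewrite lef_pV2 ?posrE ?mulr_gt0 ?ltr_wpDl ?expR_ge0//.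
by rewrite ler_pM2l// lerD2r.
Qed.
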